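(* Let $f_\to$ be any Jeffrey conditional, and let $\models_{\mathsf{J}/\mathsf{TT}}$ be the associated $\mathsf{TT}$-consequence relation. Then: (i) (Modus Ponens) $A, A\to B\models_{\mathsf{J}/\mathsf{TT}} B$ for all formulae $A,B$; (ii) (Identity Law) $\models_{\mathsf{J}/\mathsf{TT}} A\to A$ for every formula $A$; (iii) the entailment of the conditional to its converse is invalid: there are formulae $A,B$ with $A\to B\not\models_{\mathsf{J}/\mathsf{TT}} B\to A$.
   Context: Let $\mathcal{L}_{\to}$ be the propositional language with denumerably many propositional variables $p_0, p_1, \dots$ and connectives $\neg$, $\wedge$, $\to$, and let $\mathsf{For}$ be its set of formulae. Truth values are $1$, $\tfrac12$, $0$. Negation and conjunction are Strong Kleene: $f_\neg(x) = 1-x$, $f_\wedge(x,y)=\min(x,y)$. A Jeffrey conditional is a binary operation $f_\to$ on $\{1,\tfrac12,0\}$ (first argument: antecedent; second: consequent) with $f_\to(1,1)=1$, $f_\to(1,\tfrac12)=d_1$, $f_\to(1,0)=0$, $f_\to(\tfrac12,1)=d_2$, $f_\to(\tfrac12,\tfrac12)=d_3$, $f_\to(\tfrac12,0)=0$, $f_\to(0,1)=\tfrac12$, $f_\to(0,\tfrac12)=d_4$, $f_\to(0,0)=\tfrac12$, where $d_1,d_2,d_3,d_4\in\{\tfrac12,1\}$. Given a Jeffrey conditional $f_\to$, a $\mathsf{J}$-evaluation is a function $v:\mathsf{For}\to\{1,\tfrac12,0\}$ interpreting $\neg,\wedge,\to$ by $f_\neg,f_\wedge,f_\to$ (with arbitrary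 values on the propositional variables). $\Gamma\models_{\mathsf{J}/\mathsf{TT}} A$ means: every $\mathsf{J}$-evaluation $v$ with $v(C)>0$ for all $C\in\Gamma$ satisfies $v(A)>0$; $\models A$ abbreviates $\emptyset\models A$. *)

(* Defs.v *)
From mathcomp Require Import all_boot all_order all_algebra.
From mathcomp Require Import classical_sets.

Set Implicit Arguments.
Unset Strict Implicit.
Unset Printing Implicit Defensive.

Import Order.TTheory GRing.Theory Num.Theory.
Local Open Scope classical_set_scope.
Local Open Scope ring_scope.

Inductive form : Type :=
| Var of nat
| Neg of form
| And of form & form
| Imp of form & form.

Inductive tvalue : Type := One | Half | Zero.

Definition rat_of_tvalue (x : tvalue) : rat :=
  match x with One => 1 | Half => 1 / 2 | Zero => 0 end.

Definition f_neg (x : tvalue) : tvalue :=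
  match x with One => Zero | Half => Half | Zero => One end.

Definition f_and (x y : tvalue) : tvalue :=
  match x, y with
  | Zero, _ | _, Zero => Zero
  | Half, _ | _, Half => Half
  | One, One => One
  end.

Lemma f_negE x : rat_of_tvalue (f_neg x) = 1 - rat_of_tvalue x.
Proof. by apply/eqP; case: x. Qed.

Lemma f_andE x y :
  rat_of_tvalue (f_and x y) = Num.min (rat_of_tvalue x) (rat_of_tvalue y).
Proof. by apply/eqP; case: x; case: y. Qed.

Definition is_jeffrey (f : tvalue -> tvalue -> tvalue) : Prop :=
  exists d1 d2 d3 d4 : tvalue,
    [/\ [set Half; One] d1, [set Half; One] d2,
        [set Half; One] d3 & [set Half; One] d4] /\
    [/\ f One One = One, f One Half = d1 & f One Zero = Zero] /\
    [/\ f Half One = d2, f Half Half = d3 & f Half Zero = Zero] /\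
    [/\ f Zero One = Half, f Zero Half = d4 & f Zero Zero = Half].

Definition J_evaluation (f : tvalue -> tvalue -> tvalue) (v : form -> tvalue) : Prop :=
  [/\ forall A, v (Neg A) = f_neg (v A),
      forall A B, v (And A B) = f_and (v A) (v B)
    & forall A B, v (Imp A B) = f (v A) (v B)].

Definition TT_consequence (f : tvalue -> tvalue -> tvalue)
    (Gamma : set form) (A : form) : Prop :=
  forall v : form -> tvalue, J_evaluation f v ->
    (forall C, Gamma C -> 0 < rat_of_tvalue (v C)) -> 0 < rat_of_tvalue (v A).

(* Main.v *)
From mathcomp Require Import all_boot all_order all_algebra.
Require Import Defs.
From mathcomp Require Import classical_sets.

Local Open Scope classical_set_scope.

(** Being tolerantly true means differing from [Zero], so every claim reads off the truth table,
    whatever d1, ..., d4 are. Modus Ponens and Identity are the pointwise facts [jeffrey_detach] and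
    [jeffrey_diag]. The converse fails because a false antecedent makes the conditional [Half],
    which is designated, while [f One Zero = Zero]. *)

Lemma rat_of_tvalue_gt0P (x : tvalue) : (0 < rat_of_tvalue x)%R <-> x <> Zero.
Proof. by case: x. Qed.

(** In the column of consequent [Zero], the rows of designated antecedents [One] and [Half] both
    contain [Zero]. *)
Lemma jeffrey_detach (f : tvalue -> tvalue -> tvalue) (x y : tvalue) :
  is_jeffrey f -> x <> Zero -> f x y <> Zero -> y <> Zero.
Proof.
case=> d1 [d2 [d3 [d4 [_ [[_ _ f10] [[_ _ fh0] _]]]]]].
by case: x y => [] [] //; rewrite ?f10 ?fh0.
Qed.

(** The diagonal is [One], d3, [Half], and d3 is [Half] or [One]. *)
Lemma jeffrey_diag (f : tvalue -> tvalue -> tvalue) (x : tvalue) :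
  is_jeffrey f -> f x x <> Zero.
Proof.
case=> d1 [d2 [d3 [d4 [[_ _ d3P _] [[f11 _ _] [[_ fhh _] [_ _ f00]]]]]]].
by case: x; rewrite ?f11 ?fhh ?f00 //; case: d3P => ->.
Qed.

(** Extends an assignment of the variables to all formulae, so that a countermodel can be given by
    its values on variables. *)
Fixpoint eval (f : tvalue -> tvalue -> tvalue) (e : nat -> tvalue)
    (A : form) : tvalue :=
  match A with
  | Var n => e n
  | Neg B => f_neg (eval f e B)
  | And B C => f_and (eval f e B) (eval f e C)
  | Imp B C => f (eval f e B) (eval f e C)
  end.

Lemma eval_J_evaluation (f : tvalue -> tvalue -> tvalue) (e : nat -> tvalue) :
  J_evaluation f (eval f e).
Proof. by []. Qed.

Theorem proposition5p4 (f : tvalue -> tvalue -> tvalue) (hf : is_jeffrey f) :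
  (forall A B : form, TT_consequence f [set A; Imp A B] B) /\
  (forall A : form, TT_consequence f set0 (Imp A A)) /\
  (exists A B : form, ~ TT_consequence f [set Imp A B] (Imp B A)).
Proof.
split; [|split].
- move=> A B v [_ _ vImp] vG; apply/rat_of_tvalue_gt0P.
  apply: (jeffrey_detach f (v A) (v B) hf).
    by apply/rat_of_tvalue_gt0P/vG; left.
  by rewrite -vImp; apply/rat_of_tvalue_gt0P/vG; right.
- move=> A v [_ _ vImp] _; apply/rat_of_tvalue_gt0P.
  by rewrite vImp; apply: jeffrey_diag.
- exists (Var 0), (Var 1) => imp_conv.
  case: hf => d1 [d2 [d3 [d4 [_ [[_ _ f10] [_ [f01 _ _]]]]]]].
  (* With p0 false and p1 true, p0 → p1 gets [f Zero One = Half] and p1 → p0 gets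
     [f One Zero = Zero]. *)
  pose v := eval f (fun n => if n is 0 then Zero else One).
  have /rat_of_tvalue_gt0P : (0 < rat_of_tvalue (v (Imp (Var 1) (Var 0))))%R.
    apply: imp_conv; first exact: eval_J_evaluation.
    by move=> C ->; apply/rat_of_tvalue_gt0P; rewrite /v /= f01.
  by rewrite /v /= f10.
Qed.
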